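(* Let $q$ be a complex number with $|q|<1$, and let $c,d,z$ be complex numbers with $|cq|<1$ (and such that no denominator below vanishes, in particular $c\neq0$). Then \[ \sum_{n=1}^{\infty}\frac{(-z)^n\,(c/d;q)_n\, d^n\, q^{n(n+1)/2}}{(zq;q)_n\,(cq;q)_n}=\frac{z(c-d)}{c}\sum_{n=1}^{\infty}\frac{(zdq/c;q)_{n-1}\,(cq)^n}{(zq;q)_n}. \]
   Context: For a complex number $A$ and $|q|<1$, the $q$-Pochhammer symbol is $(A;q)_0=1$ and $(A;q)_n=(1-A)(1-Aq)\cdots(1-Aq^{n-1})$ for $n\ge 1$. Here $(c/d;q)_n d^n$ is understood as the polynomial $\prod_{k=0}^{n-1}(d-cq^k)$ in $d$. *)

(* Defs.v *)
From Stdlib Require Import Reals.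
From Coquelicot Require Import Coquelicot.

Open Scope C_scope.

Fixpoint qpoch (A q : C) (n : nat) : C :=
  match n with
  | O => 1
  | S k => qpoch A q k * (1 - A * q ^ k)
  end.

(* The polynomial $\prod_{k<n} (d - c q^k)$ denoted by $(c/d;q)_n d^n$,
   also meaningful at $d = 0$ *)
Fixpoint qpoch_hom (c d q : C) (n : nat) : C :=
  match n with
  | O => 1
  | S k => qpoch_hom c d q k * (d - c * q ^ k)
  end.

Lemma qpoch_homE (c d q : C) (n : nat) :
  d <> 0 -> qpoch_hom c d q n = qpoch (c / d) q n * d ^ n.
Proof.
intros Hd; induction n as [|n IH]; simpl; [|rewrite IH]; now field.
Qed.

(* Main.v *)
(** Put [t = c q] and [b = z d / c], and let
    [S(z, t) = sum_m (b q; q)_m t^m / (z q; q)_(m+1)], so that the right-hand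
    side is [(z - b) t S(z, t)].  Comparing [S(z, t)] with its shift by one
    index gives
      [(1 - t) (1 - z q) S(z, t) = 1 - t q (b - z q) S(z q, t q)].
    Iterating this relation from [(z, t)] to [(z q^N, t q^N)] produces the
    [N]-th partial sum of the left-hand series, up to the factor [(z - b) t],
    plus a remainder [P_N S(z q^N, t q^N)].  The remainder vanishes in the limit:
    [P_(N+1) / P_N] tends to [0] and [S(z q^N, t q^N)] stays bounded. *)

Require Import Defs.
From Stdlib Require Import Reals Lra Lia.
From Coquelicot Require Import Coquelicot.

Open Scope C_scope.

(** * Complex series: uniqueness of sums, ratio test and geometric bounds *)

Lemma is_series_C_unique (a : nat -> C) (l1 l2 : C) :
  is_series (K := C_AbsRing) (V := C_NormedModule) a l1 ->
  is_series (K := C_AbsRing) (V := C_NormedModule) a l2 -> l1 = l2.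
Proof.
intros H1 H2.
exact (filterlim_locally_unique (K := C_AbsRing) (V := C_NormedModule) _ _ _ H1 H2).
Qed.

Lemma Cmod_le_geom (a : nat -> C) (k : R) :
  (0 <= k)%R -> (forall n, Cmod (a (S n)) <= k * Cmod (a n))%R ->
  forall n, (Cmod (a n) <= Cmod (a O) * k ^ n)%R.
Proof.
intros Hk Ha n; induction n as [|n IH]; simpl; [lra|].
generalize (Ha n) (Rmult_le_compat_l k _ _ Hk IH); lra.
Qed.

Lemma is_series_geom_scal (x k : R) :
  (0 <= k < 1)%R -> is_series (fun n => x * k ^ n)%R (x * / (1 - k))%R.
Proof.
intros Hk; apply (is_series_scal_l (K := R_AbsRing) (V := R_NormedModule) x).
apply is_series_geom.
rewrite Rabs_pos_eq; lra.
Qed.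

Lemma ex_series_Cmod_ratio (a : nat -> C) (k : R) (N : nat) :
  (0 <= k < 1)%R ->
  (forall n, (N <= n)%nat -> Cmod (a (S n)) <= k * Cmod (a n))%R ->
  ex_series (fun n => Cmod (a n)).
Proof.
intros Hk Ha.
apply (ex_series_incr_n (fun n => Cmod (a n)) N).
apply (ex_series_le (V := R_CompleteNormedModule) _
         (fun n => Cmod (a (N + 0)%nat) * k ^ n)%R).
- intros n; change (Rabs (Cmod (a (N + n)%nat)) <= Cmod (a (N + 0)%nat) * k ^ n)%R.
  rewrite Rabs_pos_eq by apply Cmod_ge_0.
  apply (Cmod_le_geom (fun n => a (N + n)%nat)); [lra|].
  intros m; rewrite Nat.add_succ_r; apply Ha; lia.
- eexists; apply is_series_geom_scal, Hk.
Qed.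

Lemma ex_series_C_ratio (a : nat -> C) (k : R) (N : nat) :
  (0 <= k < 1)%R ->
  (forall n, (N <= n)%nat -> Cmod (a (S n)) <= k * Cmod (a n))%R ->
  ex_series (K := C_AbsRing) (V := C_NormedModule) a.
Proof.
intros Hk Ha.
apply (ex_series_le (V := C_CompleteNormedModule) a (fun n => Cmod (a n))).
- intros n; apply Rle_refl.
- exact (ex_series_Cmod_ratio a k N Hk Ha).
Qed.

Lemma Cmod_series_ratio_le (a : nat -> C) (k : R) (s : C) :
  (0 <= k < 1)%R -> (forall n, Cmod (a (S n)) <= k * Cmod (a n))%R ->
  is_series (K := C_AbsRing) (V := C_NormedModule) a s ->
  (Cmod s <= Cmod (a O) * / (1 - k))%R.
Proof.
intros Hk Ha Hs.
apply (is_lim_seq_le (fun n => Cmod (sum_n (G := C_NormedModule) a n))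
         (sum_n (fun n => Cmod (a O) * k ^ n)%R)
         (Cmod s) (Cmod (a O) * / (1 - k))%R).
- intros n; eapply Rle_trans.
  + apply (norm_sum_n_m (K := C_AbsRing) (V := C_NormedModule) a 0 n).
  + apply sum_n_m_le; intros m; apply Cmod_le_geom; [lra|exact Ha].
- exact (filterlim_comp _ _ _ _ _ _ _ _ Hs
           (filterlim_norm (K := C_AbsRing) (V := C_NormedModule) s)).
- exact (is_series_geom_scal (Cmod (a O)) k Hk).
Qed.

(** * Modulus estimates for ratios and for powers of [q] *)

Lemma Cmod_1_minus_ge (w : C) : (1 - Cmod w <= Cmod (1 - w))%R.
Proof.
generalize (Cmod_triangle (1 - w) w).
replace (1 - w + w) with (RtoC 1) by ring.
rewrite Cmod_1; lra.
Qed.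

Lemma Cmod_minus_le (v w : C) : (Cmod (v - w) <= Cmod v + Cmod w)%R.
Proof.
rewrite <- (Cmod_opp w); apply Cmod_triangle.
Qed.

(** Shaped for ratio tests: when the next term is [x * (y / w)], it remains to compare the numerator
    [y] with the denominator [w], without division. *)
Lemma Cmod_mult_div_le (x y w : C) (k : R) :
  w <> 0 -> (Cmod y <= k * Cmod w)%R -> (Cmod (x * (y / w)) <= k * Cmod x)%R.
Proof.
intros Hw Hy.
rewrite Cmod_mult, Cmod_div by exact Hw.
assert (Hw' := proj1 (Cmod_gt_0 w) Hw).
rewrite (Rmult_comm k); apply Rmult_le_compat_l; [apply Cmod_ge_0|].
apply Rle_div_l; lra.
Qed.

Lemma Cmod_mult_pow_le (q w : C) (n : nat) :
  (Cmod q <= 1)%R -> (Cmod (w * q ^ n) <= Cmod w)%R.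
Proof.
intros Hq; rewrite Cmod_mult, Cmod_pow.
assert (H := pow_incr (Cmod q) 1 n (conj (Cmod_ge_0 q) Hq)).
rewrite pow1 in H; generalize (Cmod_ge_0 w); nra.
Qed.

(** The threshold depends on [w] only through the bound [K], so a single [N] serves several
    parameters at once. *)
Lemma Cpow_eventually_small (q : C) (K eps : R) :
  (Cmod q < 1)%R -> (0 < eps)%R ->
  exists N, forall n, (N <= n)%nat ->
    forall w, (Cmod w <= K)%R -> (Cmod (w * q ^ n) <= eps)%R.
Proof.
intros Hq He.
(* [Rabs K + 1] is a positive bound for [w] whatever the sign of [K], so dividing by it is safe. *)
assert (HK : (0 < Rabs K + 1)%R) by (generalize (Rabs_pos K); lra).
destruct (pow_lt_1_zero (Cmod q)) with (y := (eps / (Rabs K + 1))%R) as [N HN].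
- now rewrite Rabs_pos_eq by apply Cmod_ge_0.
- now apply Rdiv_lt_0_compat.
- exists N; intros n Hn w Hw.
  specialize (HN n Hn).
  rewrite Rabs_pos_eq in HN by (apply pow_le, Cmod_ge_0).
  apply Rlt_div_r in HN; [|exact HK].
  rewrite Cmod_mult, Cmod_pow.
  assert (H0 : (0 <= Cmod q ^ n)%R) by apply pow_le, Cmod_ge_0.
  assert (H1 : (Cmod w <= Rabs K + 1)%R) by (generalize (Rle_abs K); lra).
  generalize (Rmult_le_compat_r _ _ _ H0 H1); lra.
Qed.

(** * Shifts and zeros of the q-Pochhammer symbol *)

Lemma qpoch_Sl (A q : C) (n : nat) :
  qpoch A q (S n) = (1 - A) * qpoch (A * q) q n.
Proof.
induction n as [|n IH]; [simpl; ring|].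
change (qpoch A q (S n) * (1 - A * q ^ S n) =
        (1 - A) * (qpoch (A * q) q n * (1 - A * q * q ^ n))).
rewrite IH, Cpow_S; ring.
Qed.

Lemma qpoch_factor_neq0 (A q : C) :
  (forall n, qpoch A q n <> 0) -> forall n, 1 - A * q ^ n <> 0.
Proof.
intros H n Hn; apply (H (S n)); simpl; rewrite Hn; ring.
Qed.

(** Peeling off the first factor shows that a zero of a shifted symbol is a zero of a longer
    unshifted one. Nonvanishing thus passes to every iterate of the parameters. *)
Lemma qpoch_shift_neq0 (A q : C) :
  (forall n, qpoch A q n <> 0) -> forall N n, qpoch (A * q ^ N) q n <> 0.
Proof.
intros H N; induction N as [|N IH]; intros n.
- replace (A * q ^ 0) with A by (simpl; ring); apply H.
- intros Hn; apply (IH (S n)); rewrite qpoch_Sl.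
  replace (A * q ^ N * q) with (A * q ^ S N) by (simpl; ring).
  rewrite Hn; ring.
Qed.

(** * The series [S(z, t)]: convergence and contiguous relation *)

(** Up to the factor [1 / (1 - z q)], the general term of 2phi1(q, b q; z q^2; q, t), where the two
    symbols (q; q)_m cancel. *)
Definition heine_term (b q z t : C) (m : nat) : C :=
  qpoch (b * q) q m * t ^ m / qpoch (z * q) q (S m).

Lemma heine_term_S (b q z t : C) (m : nat) :
  (forall n, qpoch (z * q) q n <> 0) ->
  heine_term b q z t (S m) =
  heine_term b q z t m * (t * (1 - b * q * q ^ m) / (1 - z * q * q ^ S m)).
Proof.
intros Hz.
assert (H1 := Hz (S m)); assert (H2 := qpoch_factor_neq0 _ _ Hz (S m)).
unfold heine_term.
change (qpoch (z * q) q (S (S m))) with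
  (qpoch (z * q) q (S m) * (1 - z * q * q ^ S m)).
change (qpoch (b * q) q (S m)) with (qpoch (b * q) q m * (1 - b * q * q ^ m)).
change (t ^ S m) with (t * t ^ m).
field; now split.
Qed.

Lemma ex_series_heine (b q z t : C) :
  (Cmod q < 1)%R -> (Cmod t < 1)%R -> (forall n, qpoch (z * q) q n <> 0) ->
  ex_series (K := C_AbsRing) (V := C_NormedModule) (heine_term b q z t).
Proof.
intros Hq Ht Hz.
assert (Ht0 := Cmod_ge_0 t).
(* With r = |t|, this choice gives r (1 + eps) <= (1 + r)/2 * (1 - eps), which amounts to 3 (1 -
   r)^2 >= 0; the ratio (1 + r)/2 is below 1. *)
set (eps := ((1 - Cmod t) / 4)%R).
destruct (Cpow_eventually_small q (Rmax (Cmod (b * q)) (Cmod (z * q))) eps Hq)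
  as [N HN]; [unfold eps; lra|].
apply (ex_series_C_ratio _ ((1 + Cmod t) / 2) N); [lra|].
intros n Hn; rewrite heine_term_S by exact Hz.
apply Cmod_mult_div_le; [now apply qpoch_factor_neq0|].
assert (Hb := HN n Hn (b * q) (Rmax_l _ _)).
assert (Hz1 := HN (S n) (Nat.le_trans _ _ _ Hn (Nat.le_succ_diag_r n))
                 (z * q) (Rmax_r _ _)).
assert (H1 := Cmod_minus_le 1 (b * q * q ^ n)).
assert (H2 := Cmod_1_minus_ge (z * q * q ^ S n)).
rewrite Cmod_1 in H1; rewrite Cmod_mult; unfold eps in *.
apply Rle_trans with (Cmod t * (1 + (1 - Cmod t) / 4))%R.
- apply Rmult_le_compat_l; lra.
- apply Rle_trans with ((1 + Cmod t) / 2 * (1 - (1 - Cmod t) / 4))%R; [nra|].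
  apply Rmult_le_compat_l; lra.
Qed.

(** With a_m the terms of [s], in a_(m+1) - t a_m the numerators combine as (1 - b q^(m+1)) - (1 - z
    q^(m+2)) = - q^(m+1) (b - z q). The factor q^m turns t^m into (t q)^m, so the difference is a
    constant multiple of the term with parameters [z * q] and [t * q]. Summing over m gives the
    relation. *)
Lemma heine_contiguous (b q z t s s' : C) :
  (forall n, qpoch (z * q) q n <> 0) ->
  is_series (K := C_AbsRing) (V := C_NormedModule) (heine_term b q z t) s ->
  is_series (K := C_AbsRing) (V := C_NormedModule)
    (heine_term b q (z * q) (t * q)) s' ->
  (1 - t) * (1 - z * q) * s = 1 - t * q * (b - z * q) * s'.
Proof.
intros Hz Hs Hs'.
assert (H1 : 1 - z * q <> 0).
{ generalize (qpoch_factor_neq0 _ _ Hz 0); simpl.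
  now replace (z * q * 1) with (z * q) by ring. }
assert (Hzq : forall n, qpoch (z * q * q) q n <> 0).
{ intros n; generalize (qpoch_shift_neq0 _ _ Hz 1 n); simpl.
  now replace (z * q * (q * 1)) with (z * q * q) by ring. }
(* The dropped term of index 0 is [/ (1 - z * q)]; it becomes the constant 1 of the relation. *)
assert (Hshift : is_series (K := C_AbsRing) (V := C_NormedModule)
          (fun m => heine_term b q z t (S m)) (s - / (1 - z * q))).
{ apply (is_series_incr_1 (K := C_AbsRing) (V := C_NormedModule)).
  replace (plus _ _) with s; [exact Hs|].
  change (s = s - / (1 - z * q) + heine_term b q z t 0).
  unfold heine_term; simpl; field; exact H1. }
assert (Hd := is_series_minus _ _ _ _ Hshift
                (is_series_scal_l (K := C_AbsRing) (V := C_NormedModule) t _ _ Hs)).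
assert (Hr := is_series_scal_l (K := C_AbsRing) (V := C_NormedModule)
                (- t * q * (b - z * q) / (1 - z * q)) _ _ Hs').
assert (E : s - / (1 - z * q) - t * s =
            - t * q * (b - z * q) / (1 - z * q) * s').
{ apply (is_series_C_unique _ _ _ Hd).
  eapply is_series_ext; [|exact Hr].
  intros m.
  change (- t * q * (b - z * q) / (1 - z * q) * heine_term b q (z * q) (t * q) m =
          heine_term b q z t (S m) - t * heine_term b q z t m).
  rewrite heine_term_S by exact Hz.
  unfold heine_term.
  rewrite (qpoch_Sl (z * q) q m), Cpow_mult_l.
  change (qpoch (z * q * q) q (S m)) with
    (qpoch (z * q * q) q m * (1 - z * q * q * q ^ m)).
  change (q ^ S m) with (q * q ^ m).
  assert (H2 := Hzq m); assert (H3 := qpoch_factor_neq0 _ _ Hzq m).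
  field; repeat split; try assumption.
  now replace (z * q * (q * q ^ m)) with (z * q * q * q ^ m) by ring. }
transitivity ((1 - z * q) * (s - / (1 - z * q) - t * s) + 1);
  [field; exact H1|rewrite E; field; exact H1].
Qed.

(** * Coefficients produced by iterating the contiguous relation *)

Definition heine_prefactor (b q z t : C) (n : nat) : C :=
  (- t) ^ n * q ^ Nat.div (n * (n + 1)) 2 * qpoch_hom (z * q) b q n
  / (qpoch (z * q) q n * qpoch t q n).

(** What the constant 1 of the relation contributes at step [n]: the prefactor divided by the
    coefficient of the series at that step. It differs from [heine_prefactor] only in the two
    indices [S n]. *)
Definition heine_dual_term (b q z t : C) (n : nat) : C :=
  (- t) ^ n * q ^ Nat.div (n * (n + 1)) 2 * qpoch_hom (z * q) b q n
  / (qpoch (z * q) q (S n) * qpoch t q (S n)).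

Lemma triangular_S (n : nat) :
  Nat.div (S n * (S n + 1)) 2 = (Nat.div (n * (n + 1)) 2 + S n)%nat.
Proof.
replace (S n * (S n + 1))%nat with (n * (n + 1) + S n * 2)%nat by lia.
apply Nat.div_add; lia.
Qed.

Lemma heine_prefactor_S (b q z t : C) (n : nat) :
  (forall k, qpoch (z * q) q k <> 0) -> (forall k, qpoch t q k <> 0) ->
  heine_prefactor b q z t (S n) =
  heine_prefactor b q z t n *
  (- (t * q * q ^ n) * (b - z * q * q ^ n)
   / ((1 - z * q * q ^ n) * (1 - t * q ^ n))).
Proof.
intros Hz Ht; unfold heine_prefactor.
rewrite triangular_S, Cpow_add_r; simpl.
assert (H1 := Hz n); assert (H2 := Ht n).
assert (H3 := qpoch_factor_neq0 _ _ Hz n); assert (H4 := qpoch_factor_neq0 _ _ Ht n).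
field; repeat split; assumption.
Qed.

Lemma heine_dual_termE (b q z t : C) (n : nat) :
  (forall k, qpoch (z * q) q k <> 0) -> (forall k, qpoch t q k <> 0) ->
  heine_dual_term b q z t n =
  heine_prefactor b q z t n / ((1 - z * q * q ^ n) * (1 - t * q ^ n)).
Proof.
intros Hz Ht; unfold heine_prefactor, heine_dual_term; simpl.
assert (H1 := Hz n); assert (H2 := Ht n).
assert (H3 := qpoch_factor_neq0 _ _ Hz n); assert (H4 := qpoch_factor_neq0 _ _ Ht n).
field; repeat split; assumption.
Qed.

(** * Control of the remainder *)

Lemma is_lim_heine_prefactor (b q z t : C) :
  (Cmod q < 1)%R ->
  (forall k, qpoch (z * q) q k <> 0) -> (forall k, qpoch t q k <> 0) ->
  is_lim_seq (fun n => Cmod (heine_prefactor b q z t n)) 0.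
Proof.
intros Hq Hz Ht.
apply ex_series_lim_0.
set (K := Rmax (Cmod (z * q)) (Rmax (Cmod t) (Cmod (t * q)))).
assert (Hb0 := Cmod_ge_0 b).
(* This smallness makes the numerator of the ratio at most 1/8, while the two denominators are at
   least 7/8 each; the ratio is then below 1/2. *)
assert (He : (0 < / (8 * (Cmod b + 1)))%R) by (apply Rinv_0_lt_compat; lra).
assert (He' : (/ (8 * (Cmod b + 1)) <= / 8)%R) by (apply Rinv_le_contravar; lra).
destruct (Cpow_eventually_small q K _ Hq He) as [N HN].
apply (ex_series_Cmod_ratio _ (/ 2) N); [lra|].
intros n Hn; rewrite heine_prefactor_S by assumption.
assert (H1 := HN n Hn (z * q) (Rmax_l _ _)).
assert (H2 := HN n Hn t (Rle_trans _ _ _ (Rmax_l _ _) (Rmax_r _ _))).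
assert (H3 := HN n Hn (t * q) (Rle_trans _ _ _ (Rmax_r _ _) (Rmax_r _ _))).
apply Cmod_mult_div_le.
- apply Cmult_neq_0; now apply qpoch_factor_neq0.
- rewrite !Cmod_mult with (x := - _), Cmod_opp.
  rewrite (Cmod_mult (1 - _)).
  assert (H4 := Cmod_minus_le b (z * q * q ^ n)).
  assert (H5 := Cmod_1_minus_ge (z * q * q ^ n)).
  assert (H6 := Cmod_1_minus_ge (t * q ^ n)).
  apply Rle_trans with (/ (8 * (Cmod b + 1)) * (Cmod b + 1))%R.
  + apply Rmult_le_compat; try apply Cmod_ge_0; lra.
  + replace (/ (8 * (Cmod b + 1)) * (Cmod b + 1))%R with (/ 8)%R by (field; lra).
    nra.
Qed.

(** Once [z * q ^ n] and [t * q ^ n] are small, the series is dominated by a geometric one of ratio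
    1/2 whose first term is at most 4/3, uniformly in [n]. *)
Lemma heine_tail_bounded (b q z t : C) :
  (Cmod q < 1)%R -> (forall k, qpoch (z * q) q k <> 0) ->
  exists N, forall n, (N <= n)%nat -> forall s,
    is_series (K := C_AbsRing) (V := C_NormedModule)
      (heine_term b q (z * q ^ n) (t * q ^ n)) s -> (Cmod s <= 4)%R.
Proof.
intros Hq Hz.
set (K := Rmax (Cmod z) (Cmod t)).
assert (Hb0 := Cmod_ge_0 b).
(* Numerators of the ratio are then at most 1/4 and denominators at least 3/4. *)
assert (He : (0 < / (4 * (Cmod b + 1)))%R) by (apply Rinv_0_lt_compat; lra).
assert (He' : (/ (4 * (Cmod b + 1)) <= / 4)%R) by (apply Rinv_le_contravar; lra).
destruct (Cpow_eventually_small q K _ Hq He) as [N HN].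
exists N; intros n Hn s Hs.
assert (Hzn : forall k, qpoch (z * q ^ n * q) q k <> 0).
{ intros k; replace (z * q ^ n * q) with (z * q * q ^ n) by ring.
  now apply qpoch_shift_neq0. }
assert (Hpow : forall m w, (Cmod (w * q ^ m) <= Cmod w)%R).
{ intros m w; apply Cmod_mult_pow_le; lra. }
assert (H1 := HN n Hn z (Rmax_l _ _)).
assert (H2 := HN n Hn t (Rmax_r _ _)).
assert (Hden : forall m, (3 / 4 <= Cmod (1 - z * q ^ n * q * q ^ m))%R).
{ intros m.
  assert (H3 := Cmod_1_minus_ge (z * q ^ n * q * q ^ m)).
  assert (H4 := Hpow (S m) (z * q ^ n)).
  replace (z * q ^ n * q ^ S m) with (z * q ^ n * q * q ^ m) in H4
    by (simpl; ring).
  lra. }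
eapply Rle_trans.
- apply (Cmod_series_ratio_le _ (/ 2) _) with (3 := Hs); [lra|].
  intros m; rewrite heine_term_S by exact Hzn.
  apply Cmod_mult_div_le; [now apply qpoch_factor_neq0|].
  rewrite Cmod_mult.
  assert (H3 := Hden (S m)).
  assert (H4 := Cmod_minus_le 1 (b * q * q ^ m)).
  assert (H5 := Hpow (S m) b).
  replace (b * q ^ S m) with (b * q * q ^ m) in H5 by (simpl; ring).
  rewrite Cmod_1 in H4.
  apply Rle_trans with (/ (4 * (Cmod b + 1)) * (Cmod b + 1))%R.
  + apply Rmult_le_compat; try apply Cmod_ge_0; lra.
  + replace (/ (4 * (Cmod b + 1)) * (Cmod b + 1))%R with (/ 4)%R by (field; lra).
    lra.
- assert (H3 := Hden O).
  assert (H4 := qpoch_factor_neq0 _ _ Hzn O).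
  replace (heine_term b q (z * q ^ n) (t * q ^ n) 0) with
    (/ (1 - z * q ^ n * q * q ^ 0))
    by (unfold heine_term; simpl in *; field; now rewrite Cmult_1_r in H4).
  rewrite Cmod_inv by exact H4.
  assert (H5 : (/ Cmod (1 - z * q ^ n * q * q ^ 0) <= / (3 / 4))%R)
    by (apply Rinv_le_contravar; [lra|exact H3]).
  replace (/ (1 - / 2))%R with 2%R by field.
  lra.
Qed.

Lemma ex_series_heine_shift (b q z t : C) :
  (Cmod q < 1)%R -> (Cmod t < 1)%R -> (forall k, qpoch (z * q) q k <> 0) ->
  forall n, ex_series (K := C_AbsRing) (V := C_NormedModule)
              (heine_term b q (z * q ^ n) (t * q ^ n)).
Proof.
intros Hq Ht Hz n; apply ex_series_heine; [exact Hq| |].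
- generalize (Cmod_mult_pow_le q t n (Rlt_le _ _ Hq)); lra.
- intros k; replace (z * q ^ n * q) with (z * q * q ^ n) by ring.
  now apply qpoch_shift_neq0.
Qed.

(** * Iteration and passage to the limit *)

Lemma heine_iterate (b q z t s : C) :
  (Cmod q < 1)%R -> (Cmod t < 1)%R ->
  (forall k, qpoch (z * q) q k <> 0) -> (forall k, qpoch t q k <> 0) ->
  is_series (K := C_AbsRing) (V := C_NormedModule) (heine_term b q z t) s ->
  forall n s', is_series (K := C_AbsRing) (V := C_NormedModule)
                 (heine_term b q (z * q ^ S n) (t * q ^ S n)) s' ->
  s = sum_n (G := C_NormedModule) (heine_dual_term b q z t) n
      + heine_prefactor b q z t (S n) * s'.
Proof.
intros Hq Ht1 Hz Ht Hs.
assert (Hstep : forall n s1 s2,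
  is_series (K := C_AbsRing) (V := C_NormedModule)
    (heine_term b q (z * q ^ n) (t * q ^ n)) s1 ->
  is_series (K := C_AbsRing) (V := C_NormedModule)
    (heine_term b q (z * q ^ S n) (t * q ^ S n)) s2 ->
  heine_prefactor b q z t n * s1 =
  heine_dual_term b q z t n + heine_prefactor b q z t (S n) * s2).
{ intros n s1 s2 H1 H2.
  assert (H3 := qpoch_factor_neq0 _ _ Hz n).
  assert (H4 := qpoch_factor_neq0 _ _ Ht n).
  rewrite heine_dual_termE, heine_prefactor_S by assumption.
  assert (E : (1 - t * q ^ n) * (1 - z * q * q ^ n) * s1 =
              1 - t * q * q ^ n * (b - z * q * q ^ n) * s2).
  { replace (z * q * q ^ n) with (z * q ^ n * q) by ring.
    replace (t * q * q ^ n) with (t * q ^ n * q) by ring.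
    apply heine_contiguous.
    - intros k; replace (z * q ^ n * q) with (z * q * q ^ n) by ring.
      now apply qpoch_shift_neq0.
    - exact H1.
    - replace (z * q ^ n * q) with (z * q ^ S n) by (simpl; ring).
      now replace (t * q ^ n * q) with (t * q ^ S n) by (simpl; ring). }
  transitivity (heine_prefactor b q z t n
                / ((1 - z * q * q ^ n) * (1 - t * q ^ n))
                * ((1 - t * q ^ n) * (1 - z * q * q ^ n) * s1)).
  - field; now split.
  - rewrite E; field; now split. }
induction n as [|n IH]; intros s' Hs'.
- rewrite sum_O, <- (Hstep 0%nat s).
  + unfold heine_prefactor; simpl; field.
  + now replace (z * q ^ 0) with z by (simpl; ring);
      replace (t * q ^ 0) with t by (simpl; ring).
  + exact Hs'.
(* The intermediate sum [s1] links the induction hypothesis to one more application of the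
   relation. *)
- destruct (ex_series_heine_shift b q z t Hq Ht1 Hz (S n)) as [s1 H1].
  rewrite sum_Sn, (IH s1 H1), (Hstep (S n) s1 s' H1 Hs').
  apply Cplus_assoc.
Qed.

(* Heine's transformation of [2phi1(q, b q; z q^2; q, t)] into a [2phi2]. *)
Lemma heine_transformation (b q z t : C) :
  (Cmod q < 1)%R -> (Cmod t < 1)%R ->
  (forall k, qpoch (z * q) q k <> 0) -> (forall k, qpoch t q k <> 0) ->
  exists s,
    is_series (K := C_AbsRing) (V := C_NormedModule) (heine_term b q z t) s /\
    is_series (K := C_AbsRing) (V := C_NormedModule) (heine_dual_term b q z t) s.
Proof.
intros Hq Ht1 Hz Ht.
destruct (ex_series_heine b q z t Hq Ht1 Hz) as [s Hs].
exists s; split; [exact Hs|].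
apply (filterlim_locally_ball_norm (K := C_AbsRing) (U := C_NormedModule)).
intros eps.
destruct (heine_tail_bounded b q z t Hq Hz) as [N1 HN1].
assert (Hlim := is_lim_heine_prefactor b q z t Hq Hz Ht).
apply is_lim_seq_spec in Hlim.
(* The divisor 4 offsets the bound 4 on the tails. *)
destruct (Hlim (mkposreal (eps / 4) ltac:(generalize (cond_pos eps); lra)))
  as [N2 HN2].
exists (N1 + N2)%nat; intros n Hn.
destruct (ex_series_heine_shift b q z t Hq Ht1 Hz (S n)) as [s' Hs'].
change (Cmod (sum_n (G := C_NormedModule) (heine_dual_term b q z t) n - s)
        < eps)%R.
rewrite (heine_iterate b q z t s Hq Ht1 Hz Ht Hs n s' Hs').
match goal with |- (Cmod ?x < _)%R =>
  replace x with (- (heine_prefactor b q z t (S n) * s')) by ring end.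
rewrite Cmod_opp, Cmod_mult.
assert (H1 := HN1 (S n) ltac:(lia) s' Hs').
assert (H2 := HN2 (S n) ltac:(lia)); simpl in H2.
rewrite Rminus_0_r, Rabs_pos_eq in H2 by apply Cmod_ge_0.
generalize (Cmod_ge_0 (heine_prefactor b q z t (S n))) (Cmod_ge_0 s'); nra.
Qed.

(** * Homogeneous Pochhammer products and the final identity *)

Lemma qpoch_hom_scal (x c d q : C) (n : nat) :
  x ^ n * qpoch_hom c d q n = qpoch_hom (x * c) (x * d) q n.
Proof.
induction n as [|n IH]; simpl; [ring|].
rewrite <- IH; ring.
Qed.

Lemma qpoch_hom_Sl (c d q : C) (n : nat) :
  qpoch_hom c d q (S n) = (d - c) * qpoch_hom (c * q) d q n.
Proof.
induction n as [|n IH]; [simpl; ring|].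
change (qpoch_hom c d q (S n) * (d - c * q ^ S n) =
        (d - c) * (qpoch_hom (c * q) d q n * (d - c * q * q ^ n))).
rewrite IH, Cpow_S; ring.
Qed.

Theorem theorem2p2 (q c d z : C)
  (hq : (Cmod q < 1)%R)
  (hcq : (Cmod (c * q) < 1)%R)
  (hc : c <> 0)
  (hzqn : forall n : nat, qpoch (z * q) q n <> 0)
  (hcqn : forall n : nat, qpoch (c * q) q n <> 0) :
  exists L M : C,
    is_series (K := C_AbsRing) (V := C_NormedModule)
      (fun m : nat =>
         let n := S m in
         (- z) ^ n * qpoch_hom c d q n * q ^ Nat.div (n * (n + 1)) 2
         / (qpoch (z * q) q n * qpoch (c * q) q n)) L /\
    is_series (K := C_AbsRing) (V := C_NormedModule)
      (fun m : nat =>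
         let n := S m in
         qpoch (z * d * q / c) q (n - 1) * (c * q) ^ n
         / qpoch (z * q) q n) M /\
    L = z * (c - d) / c * M.
Proof.
set (b := z * d / c).
destruct (heine_transformation b q z (c * q) hq hcq hzqn hcqn) as [s [H1 H2]].
(* Both sums start at n = 1, hence the extracted factor [c * q]; moreover z (c - d) / c = z - b. *)
exists ((z - b) * (c * q) * s), (c * q * s); split; [|split].
- eapply is_series_ext;
    [|exact (is_series_scal_l (K := C_AbsRing) (V := C_NormedModule)
               ((z - b) * (c * q)) _ _ H2)].
  intros m.
  change ((z - b) * (c * q) * heine_dual_term b q z (c * q) m =
          (- z) ^ S m * qpoch_hom c d q (S m) * q ^ Nat.div (S m * (S m + 1)) 2
          / (qpoch (z * q) q (S m) * qpoch (c * q) q (S m))).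
  (* Factor by factor, -z (d - c q^k) = -c (b - z q^k); the factor k = 0 then splits off as [b - z].
     No division by [z] or [d] occurs, so either may be 0. *)
  assert (E : (- z) ^ S m * qpoch_hom c d q (S m) =
              (- c) ^ S m * ((b - z) * qpoch_hom (z * q) b q m)).
  { rewrite <- qpoch_hom_Sl, !qpoch_hom_scal.
    f_equal; unfold b; field; exact hc. }
  (* The increment q^(m+1) of the triangular power joins (-c)^(m+1) to form (-c q)^(m+1). *)
  rewrite E, triangular_S, Cpow_add_r; unfold heine_dual_term.
  replace (- (c * q)) with (- c * q) by ring.
  rewrite Cpow_mult_l, !Cpow_S.
  field; split; [apply hcqn|apply hzqn].
- eapply is_series_ext;
    [|exact (is_series_scal_l (K := C_AbsRing) (V := C_NormedModule)
               (c * q) _ _ H1)].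
  intros m.
  change (c * q * heine_term b q z (c * q) m =
          qpoch (z * d * q / c) q (S m - 1) * (c * q) ^ S m
          / qpoch (z * q) q (S m)).
  replace (S m - 1)%nat with m by lia.
  replace (z * d * q / c) with (b * q) by (unfold b; field; exact hc).
  unfold heine_term; rewrite (Cpow_S (c * q)).
  field; apply hzqn.
- unfold b; field; exact hc.
Qed.
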